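(* Let $\Omega=\Omega(u,v)$ be a solution in $E^4$ of the Betchov-Da Rios equation $\Omega_v=\Omega_u\times\Omega_{uu}\times\Omega_{uuu}$ such that the $u$-parameter curve is unit speed for all $v$, with ED$^2$-frame field $\{T,E,D,N\}$ and associated functions $\kappa,\sigma,\tau$ (notation and standing assumptions as in the context). Then the derivative formulas of the ED$^2$-frame field are $$T_u=\kappa N,\quad E_u=\sigma D+\tau N,\quad D_u=-\sigma E,\quad N_u=-\kappa T-\tau E,$$ and $$T_v=a_{12}E+a_{13}D+a_{14}N,\quad E_v=-a_{12}T+a_{23}D+a_{24}N,$$ $$D_v=-a_{13}T-a_{23}E+a_{34}N,\quad N_v=-a_{14}T-a_{24}E-a_{34}D,$$ where $$a_{12}=-\kappa^2\tau\sigma,\qquad a_{13}=\kappa\,(2\tau\kappa_u+\kappa\tau_u),\qquad a_{14}=0,$$ $$a_{24}=2\kappa\sigma\tau_u+\tau(\kappa\sigma_u+4\sigma\kappa_u),$$ $$a_{34}=\frac1\kappa\Big(\big(\kappa\tau\sigma^2-4\kappa_u\tau_u-\kappa\tau_{uu}\big)\kappa-2\big(\kappa_u^2+\kappa\kappa_{uu}\big)\tau\Big),$$ $$a_{23}=\frac{-1}{\tau\kappa^2}\Big(-3\kappa^3\tau\sigma\sigma_u+\kappa^5\tau_u+2\kappa^4\tau\kappa_u-2\tau\kappa_u^3-\kappa^2\sigma^2(3\kappa\tau_u+5\tau\kappa_u)+2\kappa\kappa_u(\kappa_u\tau_u+2\tau\kappa_{uu})+\kappa^3\tau_{uuu}+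\kappa^2(5\kappa_u\tau_{uu}+6\tau_u\kappa_{uu}+2\tau\kappa_{uuu})\Big).$$
   Context: $E^4$ is Euclidean 4-space with inner product $\langle\cdot,\cdot\rangle$, and $x\times y\times z$ is the usual alternating ternary vector product of $E^4$ (with a fixed sign convention, e.g. $\langle w,x\times y\times z\rangle=\det(w,x,y,z)$). Subscripts $u,v$ denote partial derivatives. All functions are assumed sufficiently smooth on an open domain of the $(u,v)$-plane. ED$^2$-frame field: for each $v$, the unit speed curve $u\mapsto\Omega(u,v)$ lies on an oriented hypersurface of $E^4$; $T=\Omega_u$ is its unit tangent and $N(u,v)$ is the unit normal of the hypersurface at $\Omega(u,v)$. One is in the case where $\{N,T,\Omega_{uu}\}$ is linearly dependent, and $$E=\frac{\Omega_{uuu}-\langle\Omega_{uuu},N\rangle N-\langle\Omega_{uuu},T\rangle T}{\|\Omega_{uuu}-\langle\Omega_{uuu},N\rangle N-\langle\Omega_{uuu},T\rangle T\|},\qquad D=N\times T\times E .$$ The orthonormal frame field $\{T,E,D,N\}$ is the ED$^2$-frame field (extended Darboux frame of the second kind). Associated functions: $\kappa=\kappa_n=\langle T_u,N\rangle$ (normal curvature), $\sigma=\kappa_g^2=\langle E_u,D\rangle$ (geodesic curvature of order 2; the superscript in $\kappa_g^2$ is an index, not a power), $\tau=\tau_g^1=\langle E_u,N\rangle$ (geodesic torsion of order 1). Standing assumption: $\kappa$ and $\tau$ are nowhere zero. *)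

(* Defs.v *)
From HB Require Import structures.
From mathcomp Require Import all_boot all_order all_algebra.
From mathcomp Require Import all_classical all_reals all_analysis.

Set Implicit Arguments.
Unset Strict Implicit.
Unset Printing Implicit Defensive.
Import Order.TTheory GRing.Theory Num.Theory.
Import numFieldNormedType.Exports.

Local Open Scope classical_set_scope.
Local Open Scope ring_scope.

Section Euclidean4.
Context {R : realType}.
Implicit Types x y z : 'rV[R]_4.

Definition dot x y : R := \sum_(i < 4) x 0 i * y 0 i.

(* The norm `|x| that the library puts on row vectors is the sup norm; the
   metric notions below use this Euclidean one.  (Both give the same topology,
   hence the same limits and derivatives.) *)
Definition enorm x : R := Num.sqrt (dot x x).

(* x \times y \times z, with the sign convention
   dot w (tprod x y z) = det (w, x, y, z). *)
Definition tprod x y z : 'rV[R]_4 :=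
  \row_(j < 4) \det (\matrix_(i < 4) [:: delta_mx 0 j; x; y; z]`_i).

Definition grad (f : 'rV[R]_4 -> R) x : 'rV[R]_4 :=
  \row_(j < 4) 'D_(delta_mx 0 j) f x.

(* M is an embedded hypersurface oriented by the unit normal field nu (only the
   values of nu on M matter): locally M is the zero set of a C^1 function with
   nowhere vanishing gradient, and nu is the normalized gradient. *)
Definition oriented_hypersurface (M : set 'rV[R]_4)
    (nu : 'rV[R]_4 -> 'rV[R]_4) : Prop :=
  forall p, M p -> exists (W : set 'rV[R]_4) (f : 'rV[R]_4 -> R),
    [/\ open W, W p,
        forall q, W q -> [/\ differentiable f q,
          {for q, continuous (grad f)} & grad f q != 0],
        forall q, W q -> (M q <-> f q = 0) &
        forall q, W q -> M q -> nu q = (enorm (grad f q))^-1 *: grad f q].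

End Euclidean4.

Section Partial.
Context {R : realType} {V : normedModType R}.
Implicit Types f : R * R -> V.

Definition du f : R * R -> V := fun p => 'D_((1, 0) : R * R) f p.
Definition dv f : R * R -> V := fun p => 'D_((0, 1) : R * R) f p.

(* f is of class C^k on U (meaningful for open U). *)
Fixpoint class_C (k : nat) (U : set (R * R)) f : Prop :=
  if k is k'.+1 then
    [/\ forall p, U p -> derivable f p ((1, 0) : R * R),
        forall p, U p -> derivable f p ((0, 1) : R * R),
        class_C k' U (du f) & class_C k' U (dv f)]
  else forall p, U p -> {for p, continuous f}.

End Partial.

Section ED2.
Context {R : realType}.
Variables Omega N : R * R -> 'rV[R]_4.

Definition ED2_T : R * R -> 'rV[R]_4 := du Omega.

(* The part of Omega_uuu orthogonal to N and T. *)
Definition ED2_perp (p : R * R) : 'rV[R]_4 :=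
  let O3 := du (du (du Omega)) p in
  O3 - dot O3 (N p) *: N p - dot O3 (ED2_T p) *: ED2_T p.

Definition ED2_E (p : R * R) : 'rV[R]_4 := (enorm (ED2_perp p))^-1 *: ED2_perp p.

Definition ED2_D (p : R * R) : 'rV[R]_4 := tprod (N p) (ED2_T p) (ED2_E p).

Definition normal_curvature (p : R * R) : R := dot (du ED2_T p) (N p).
Definition geodesic_curvature2 (p : R * R) : R := dot (du ED2_E p) (ED2_D p).
Definition geodesic_torsion1 (p : R * R) : R := dot (du ED2_E p) (N p).

(* {ED2_T, ED2_E, ED2_D, N} is the ED^2-frame field of Omega over U.  The
   hypersurface may vary with v.  The last clause makes the normalization in
   ED2_E meaningful. *)
Definition is_ED2_frame_field (U : set (R * R)) : Prop :=
  [/\ forall v : R, exists (M : set 'rV[R]_4) (nu : 'rV[R]_4 -> 'rV[R]_4),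
        oriented_hypersurface M nu /\
        (forall u : R, U (u, v) ->
           M (Omega (u, v)) /\ N (u, v) = nu (Omega (u, v))),
      forall p, U p -> enorm (ED2_T p) = 1,
      forall p, U p -> ~~ free [:: N p; ED2_T p; du (du Omega) p] &
      forall p, U p -> ED2_perp p != 0].

End ED2.

(* Main.v *)
(* As the curve lies on its hypersurface, T is orthogonal to N, and the dependence
   of N, T, Omega_uu forces T_u = kappa N.  Hence Omega_uuu has no component outside
   the span of N, T and N_u, so that N_u lies in the span of T and E; orthonormality
   then gives all u-derivatives.  They turn the Betchov-Da Rios equation into
   Omega_v = kappa^2 tau D.  Equality of mixed partials, applied successively to
   Omega, T and N and projected on the frame, determines T_v, then N_v, and finally
   the last coefficient a23 = <E_v, D>, dividing by kappa and by tau respectively. *)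
Require Import Defs.
From HB Require Import structures.
From mathcomp Require Import all_boot all_order all_algebra.
From mathcomp Require Import all_classical all_reals all_analysis.
From mathcomp Require Import perm ring lra.

Set Implicit Arguments.
Unset Strict Implicit.
Unset Printing Implicit Defensive.
Import Order.TTheory GRing.Theory Num.Theory.
Import numFieldNormedType.Exports.

Local Open Scope classical_set_scope.
Local Open Scope ring_scope.

(** [class_C] only records derivatives along the two axes, with continuity at the last order, so the
    symmetry of mixed partials and the inclusion of C^(k+1) in C^k have to be established before any
    frame computation. The order 7 is a count of losses: [T] has 6 derivatives, [kappa] 5, [E] and
    [D] 4 since they are built from Omega_uuu, [sigma] and [tau] 3 since they contain E_u; tau_uuu
    in a23 uses up the last of them. Every v-coefficient comes from one pattern: differentiate <F_u,
    G> = const in v and <F_v, G> = a in u, then compare. This yields <G_v, F_u>, so what can be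
    learnt depends on F_u. For F = Omega it is T, which gives T_v. For F = T it is kappa N, which
    gives N_v and explains the division by kappa. Only F = N has a u-derivative with an E-component,
    -tau E, so a23 can be reached only through N and costs a division by tau. *)

(** * Mean values, Schwarz's theorem and the chain rule along a line *)

Lemma is_derive_line (R : realType) (V W : normedModType R) (f : V -> W)
    (x a : V) (t : R) :
  derivable f (x + t *: a) a ->
  is_derive t 1 (fun s => f (x + s *: a)) ('D_a f (x + t *: a)).
Proof.
move=> fa.
have H : (fun h : R => h^-1 *: (((fun s => f (x + s *: a)) \o shift t) (h *: 1) -
    f (x + t *: a))) =
   (fun h => h^-1 *: ((f \o shift (x + t *: a)) (h *: a) - f (x + t *: a))).
  apply/funext => h /=; congr (_ *: (f _ - _)).
  by rewrite [h *: 1]mulr1 scalerDl addrCA.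
by apply: DeriveDef; rewrite /derivable /derive H.
Qed.

(** Stating the range of [c] by a distance to [x] spares the callers a case distinction on the sign
    of the increment [y - x]. *)
Lemma MVT_sym (R : realType) (f df : R -> R) (x y : R) :
  (forall c, `|c - x| <= `|y - x| -> is_derive c 1 f (df c)) ->
  exists2 c, `|c - x| <= `|y - x| & f y - f x = df c * (y - x).
Proof.
move=> fdf.
have cont (a b : R) : (forall c : R, c \in `[a, b] -> is_derive c 1 f (df c)) ->
    {within `[a, b], continuous f}.
  by move=> H; apply: derivable_within_continuous => c /H[].
have [xy|/ltW yx] := leP x y.
- have H (c : R) : c \in `[x, y] -> is_derive c 1 f (df c).
    rewrite in_itv/= => /andP[xc cy]; apply: fdf.
    by rewrite !ger0_norm ?subr_ge0 ?lerD2r.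
  have Ho (c : R) : c \in `]x, y[ -> is_derive c 1 f (df c).
    by move=> c_; apply: H; apply: subset_itv_oo_cc c_.
  have [c + ->] := MVT_segment xy Ho (cont x y H).
  rewrite in_itv/= => /andP[xc cy]; exists c => //.
  by rewrite !ger0_norm ?subr_ge0 ?lerD2r.
- have H (c : R) : c \in `[y, x] -> is_derive c 1 f (df c).
    rewrite in_itv/= => /andP[yc cx]; apply: fdf.
    by rewrite !ler0_norm ?subr_le0// !opprB lerD2l lerN2.
  have Ho (c : R) : c \in `]y, x[ -> is_derive c 1 f (df c).
    by move=> c_; apply: H; apply: subset_itv_oo_cc c_.
  have [c + e] := MVT_segment yx Ho (cont y x H).
  rewrite in_itv/= => /andP[yc cx]; exists c.
    by rewrite !ler0_norm ?subr_le0// !opprB lerD2l lerN2.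
  by rewrite -opprB e -mulrN opprB.
Qed.

(** Pulling the neighbourhood back along the continuous map (s, t) |-> p + s a + t b gives a square
    of parameters on which the mean value theorem can be used. *)
Lemma near_plane (R : realType) (V : normedModType R) (p a b : V) (P : set V) :
  (\forall q \near p, P q) ->
  exists2 r : R, 0 < r &
    forall s t : R, `|s| < r -> `|t| < r -> P (p + s *: a + t *: b).
Proof.
move=> Pp.
pose g (st : R * R) := p + st.1 *: a + st.2 *: b.
have gc : {for (0, 0), continuous g}.
  apply: (@cvgD _ _ _ _ _ (fun st => p + st.1 *: a)).
    apply: cvgD; first exact: cvg_cst.
    by apply: cvgZr_tmp; exact: cvg_fst.
  by apply: cvgZr_tmp; exact: cvg_snd.
have : \forall st \near ((0 : R, 0 : R)), P (g st).
  by apply: gc; rewrite /g/= !scale0r !addr0.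
move=> /nbhs_ballP[r /= r0 rP]; exists r => // s t sr tr.
by apply: (rP (s, t)); split; rewrite /ball/= sub0r normrN.
Qed.

(* The left-hand side is symmetric in [a] and [b], whence Schwarz's theorem. *)
Lemma second_difference (R : realType) (V : normedModType R) (f : V -> R)
    (p a b : V) (r h : R) :
  0 < r -> 0 < h < r ->
  (forall s t : R, `|s| < r -> `|t| < r ->
    derivable f (p + s *: a + t *: b) a /\
    derivable ('D_a f) (p + s *: a + t *: b) b) ->
  exists st : R * R, [/\ `|st.1| <= h, `|st.2| <= h &
    (f (p + h *: a + h *: b) - f (p + h *: a)) - (f (p + h *: b) - f p) =
      h ^+ 2 * 'D_b ('D_a f) (p + st.1 *: a + st.2 *: b)].
Proof.
move=> r0 /andP[h0 hr] H.
have rr0 : `|0 : R| < r by rewrite normr0.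
have nh : `|h - 0| = h by rewrite subr0 gtr0_norm.
(* [g] is the increment of [f] in direction [b], seen as a function of the position along [a]. The
   second difference is [g h - g 0], so one mean value point along [a] and then one along [b]
   suffice. *)
pose g s := f (p + h *: b + s *: a) - f (p + s *: a).
pose dg s := 'D_a f (p + h *: b + s *: a) - 'D_a f (p + s *: a).
have [|s + gE] := @MVT_sym _ g dg 0 h.
  move=> c; rewrite nh subr0 => ch; have cr := le_lt_trans ch hr.
  have hr' : `|h| < r by rewrite gtr0_norm.
  have [f1 _] := H c h cr hr'; rewrite addrAC in f1.
  have [f2 _] := H c 0 cr rr0; rewrite scale0r addr0 in f2.
  exact: (is_deriveB (is_derive_line f1) (is_derive_line f2)).
rewrite nh subr0 => sh; have sr := le_lt_trans sh hr.
have [|t + tE] := @MVT_sym _ (fun t => 'D_a f (p + s *: a + t *: b))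
    (fun t => 'D_b ('D_a f) (p + s *: a + t *: b)) 0 h.
  move=> c; rewrite nh subr0 => ch; have cr := le_lt_trans ch hr.
  by apply: is_derive_line; have [] := H s c.
rewrite nh subr0 => th; exists (s, t); split => //=.
have -> : f (p + h *: a + h *: b) - f (p + h *: a) - (f (p + h *: b) - f p) =
    g h - g 0.
  by rewrite /g !scale0r !addr0 [p + h *: b + _]addrAC.
rewrite gE /dg [p + h *: b + _]addrAC.
have -> : 'D_a f (p + s *: a) = 'D_a f (p + s *: a + 0 *: b).
  by rewrite scale0r addr0.
by rewrite tE; ring.
Qed.

(** The same second difference is [h ^+ 2] times either mixed derivative, each taken at some point
    near [p]. After cancelling [h ^+ 2], continuity puts both values at [p] within [e / 2] of this
    common number. *)
Lemma derive_comm (R : realType) (V : normedModType R) (f : V -> R)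
    (p a b : V) :
  (\forall q \near p, [/\ derivable f q a, derivable f q b,
     derivable ('D_a f) q b & derivable ('D_b f) q a]) ->
  {for p, continuous ('D_b ('D_a f))} -> {for p, continuous ('D_a ('D_b f))} ->
  'D_b ('D_a f) p = 'D_a ('D_b f) p.
Proof.
move=> fp cab cba; apply/eqP; rewrite -subr_eq0 -normr_le0.
apply/ler_addgt0Pr => e e0; rewrite add0r.
have e20 : 0 < e / 2 by rewrite divr_gt0.
have : \forall q \near p, [/\ derivable f q a, derivable f q b,
     derivable ('D_a f) q b & derivable ('D_b f) q a] /\
    (`|'D_b ('D_a f) p - 'D_b ('D_a f) q| <= e / 2 /\
     `|'D_a ('D_b f) p - 'D_a ('D_b f) q| <= e / 2).
  have c1 : \forall q \near p, `|'D_b ('D_a f) p - 'D_b ('D_a f) q| <= e / 2.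
    by move/cvgrPdist_le: cab => /(_ _ e20).
  have c2 : \forall q \near p, `|'D_a ('D_b f) p - 'D_a ('D_b f) q| <= e / 2.
    by move/cvgrPdist_le: cba => /(_ _ e20).
  by apply: filterS3 fp c1 c2 => q *; split.
move=> /(near_plane a b)[r r0 rP].
pose h := r / 2.
have h0 : 0 < h by rewrite divr_gt0.
have hr : h < r by rewrite /h ltr_pdivrMr// ltr_pMr// ltr1n.
have hhr : 0 < h < r by rewrite h0.
have [|[s t] [/= sh th E1]] := @second_difference _ _ f p a b r h r0 hhr.
  by move=> s t sr tr; have [[]] := rP s t sr tr.
have [|[s' t'] [/= sh' th' E2]] := @second_difference _ _ f p b a r h r0 hhr.
  by move=> s' t' sr tr; have [[]] := rP t' s' tr sr; rewrite addrAC.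
have E : 'D_b ('D_a f) (p + s *: a + t *: b) = 'D_a ('D_b f) (p + t' *: a + s' *: b).
  rewrite [p + t' *: _ + _]addrAC.
  have h20 : h ^+ 2 != 0 by rewrite expf_neq0// gt_eqF.
  by apply: (mulfI h20); rewrite -E1 -E2 [p + h *: b + _]addrAC; ring.
have [_ [d1 _]] := rP s t (le_lt_trans sh hr) (le_lt_trans th hr).
have [_ [_ d2]] := rP t' s' (le_lt_trans th' hr) (le_lt_trans sh' hr).
rewrite -(subrKA ('D_b ('D_a f) (p + s *: a + t *: b))) (splitr e).
apply: (le_trans (ler_normD _ _)); apply: lerD; first exact: d1.
rewrite E distrC; exact: d2.
Qed.

(** Near [p] both partials are bounded, and [q] is reached from [p] by a vertical and then a
    horizontal segment; the mean value theorem on each leg bounds the increment of [f]. *)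
Lemma partials_continuous (R : realType) (f : R * R -> R) (p : R * R) :
  (\forall q \near p, derivable f q (1, 0) /\ derivable f q (0, 1)) ->
  {for p, continuous (du f)} -> {for p, continuous (dv f)} ->
  {for p, continuous f}.
Proof.
move=> fp cu cv.
have bnd (a b c : R) : `|a - b| <= 1 -> `|b| <= `|a| + `|c| + 1.
  move=> ab; have := ler_normB a (a - b); rewrite subKr.
  by have := normr_ge0 c; lra.
have : \forall q \near p, (derivable f q (1, 0) /\ derivable f q (0, 1)) /\
    (`|du f p - du f q| <= 1 /\ `|dv f p - dv f q| <= 1).
  have c1 : \forall q \near p, `|du f p - du f q| <= 1.
    by move/cvgrPdist_le: cu => /(_ _ ltr01).
  have c2 : \forall q \near p, `|dv f p - dv f q| <= 1.
    by move/cvgrPdist_le: cv => /(_ _ ltr01).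
  by apply: filterS3 fp c1 c2 => q *; split.
pose eu : R * R := (1, 0); pose ev : R * R := (0, 1).
move=> /(near_plane eu ev)[r r0 rP].
(* One bound for both partials, as each stays within 1 of its value at [p]. Below, [M * d] is spent
   on each of the two legs. *)
pose M := `|du f p| + `|dv f p| + 1.
have M0 : 0 < M by rewrite ltr_wpDl// addr_ge0.
apply/cvgrPdist_le => e e0.
have [d [d0 dr dM]] : exists d : R, [/\ 0 < d, d < r & M * d + M * d <= e].
  exists (Order.min (r / 2) (e / (2 * M))); split.
  - by rewrite lt_min !divr_gt0// mulr_gt0.
  - by rewrite gt_min ltr_pdivrMr// ltr_pMr// ltr1n.
  - have : Order.min (r / 2) (e / (2 * M)) <= e / (2 * M).
      by rewrite ge_min lexx orbT.
    by rewrite ler_pdivlMr ?mulr_gt0//; lra.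
have near_d : \forall q \near p, `|q.1 - p.1| < d /\ `|q.2 - p.2| < d.
  apply/nbhs_ballP; exists d => // q [/= q1 q2].
  by rewrite /ball/= in q1 q2; rewrite ![`|_ - p.1|]distrC ![`|_ - p.2|]distrC.
near=> q; have [q1 q2] : `|q.1 - p.1| < d /\ `|q.2 - p.2| < d by near: q.
pose s := q.1 - p.1; pose t := q.2 - p.2.
have dir (x y : R) : x *: eu + y *: ev = (x, y).
  by congr pair; rewrite /= scaler0 [_ *: 1]mulr1 ?addr0 ?add0r.
have qE : q = p + s *: eu + t *: ev.
  by rewrite -addrA dir /s /t; case: (p) (q) => [? ?] [? ?]; congr pair => /=; lra.
have rr0 : `|0 : R| < r by rewrite normr0.
have n0 (x : R) : `|x - 0| = `|x| by rewrite subr0.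
have sr : `|s| < r := lt_trans q1 dr.
have tr : `|t| < r := lt_trans q2 dr.
have [|x + E1] := @MVT_sym _ (fun x => f (p + t *: ev + x *: eu))
    (fun x => du f (p + t *: ev + x *: eu)) 0 s.
  move=> c; rewrite !n0 => cs; apply: is_derive_line; rewrite addrAC.
  by have [[H _] _] := rP c t (le_lt_trans cs sr) tr; exact: H.
rewrite !n0 => xs.
have [|y + E2] := @MVT_sym _ (fun y => f (p + y *: ev))
    (fun y => dv f (p + y *: ev)) 0 t.
  move=> c; rewrite !n0 => ct; apply: is_derive_line.
  have [[_ H] _] := rP 0 c rr0 (le_lt_trans ct tr).
  by rewrite scale0r addr0 in H; exact: H.
rewrite !n0 => yt.
have [_ [b1 _]] := rP x t (le_lt_trans xs sr) tr; rewrite addrAC in b1.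
have [_ [_ b2]] := rP 0 y rr0 (le_lt_trans yt tr).
rewrite scale0r addr0 in b2.
have {b1} B1 : `|du f (p + t *: ev + x *: eu)| <= M by exact: (bnd _ _ _ b1).
have {b2} B2 : `|dv f (p + y *: ev)| <= M.
  rewrite /M (addrC `|du f p|); exact: (bnd _ _ _ b2).
rewrite distrC.
have -> : f q - f p = du f (p + t *: ev + x *: eu) * (s - 0) +
    dv f (p + y *: ev) * (t - 0).
  by rewrite -E1 -E2 !scale0r !addr0 [p + t *: _ + _]addrAC -qE; ring.
rewrite !subr0; apply: (le_trans (ler_normD _ _)); apply: (le_trans _ dM).
rewrite !normrM; apply: lerD; apply: ler_pM => //; exact: ltW.
Unshelve. all: by end_near. Qed.

Lemma is_derive_lineP (R : realType) (V W : normedModType R) (f : V -> W)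
    (p w : V) (df : W) :
  is_derive p w f df <-> is_derive (0 : R) 1 (fun h : R => f (h *: w + p)) df.
Proof.
have H : (fun h : R => h^-1 *: (((fun h : R => f (h *: w + p)) \o shift (0 : R))
      (h *: (1 : R)) - f ((0 : R) *: w + p))) =
    (fun h => h^-1 *: ((f \o shift p) (h *: w) - f p)).
  by apply/funext => h /=; rewrite scale0r add0r addr0 [h *: 1]mulr1.
by split=> -[d1 d2]; apply: DeriveDef; move: d1 d2; rewrite /derivable /derive H.
Qed.

(** [f] is derivable in the direction [w] only and may fail to be differentiable. Restricted to the
    line through [p] it is a function of one variable, for which the two notions agree, and the
    chain rule applies there. *)
Lemma is_derive_comp (R : realType) (V W : normedModType R)
    (f : V -> W) (g : W -> R) (p w : V) (df : W) :
  is_derive p w f df -> differentiable g (f p) ->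
  is_derive p w (fun q => g (f q)) ('d g (f p) df).
Proof.
move=> /is_derive_lineP df_ dg; apply/is_derive_lineP.
have [/derivable1_diffP d1 d2] := df_.
have e0 : f p = (fun h : R => f (h *: w + p)) (0 : R) by rewrite scale0r add0r.
rewrite e0 in dg *.
apply: DeriveDef; first exact/derivable1_diffP/differentiable_comp.
rewrite deriveE; last exact: differentiable_comp.
have e2 : 'd (fun h : R => f (h *: w + p)) (0 : R) 1 = df by rewrite -deriveE.
by rewrite diff_comp//= e2.
Qed.

(** * Functions of class C^k *)

Section calculus.
Context {R : realType}.
Implicit Types (V : normedModType R) (U : set (R * R)) (k : nat).

Lemma near_open (T : topologicalType) (U : set T) p :
  open U -> U p -> \forall q \near p, U q.
Proof. by move=> oU Up; apply: open_nbhs_nbhs. Qed.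

Lemma eq_on_derive V (W : normedModType R) (U : set W) (f g : W -> V) p w :
  open U -> U p ->
  (forall q, U q -> f q = g q) -> 'D_w f p = 'D_w g p.
Proof.
by move=> oU Up fg; apply: near_eq_derive; apply: filterS (near_open oU Up).
Qed.

Lemma eq_on_derivable V (W : normedModType R) (U : set W) (f g : W -> V) p w :
  open U -> U p ->
  (forall q, U q -> f q = g q) -> derivable f p w -> derivable g p w.
Proof.
by move=> oU Up fg; apply: near_eq_derivable; apply: filterS (near_open oU Up).
Qed.

(** The differentiation rules hold only on [U], so they cannot be rewritten as equalities of
    functions inside [class_C]; openness lets the derivatives agree on [U] as well. *)
Lemma class_C_eq_on V k U (f g : R * R -> V) : open U ->
  (forall q, U q -> f q = g q) -> class_C k U f -> class_C k U g.
Proof.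
move=> oU; elim: k f g => [|k IH] f g fg /=.
  move=> cf p Up; have := cf p Up; rewrite /prop_for /continuous_at fg//.
  apply: cvg_trans; apply: near_eq_cvg; apply: filterS (near_open oU Up) => q Uq.
  by rewrite fg.
case=> f1 f2 cu cv; split.
- by move=> p Up; apply: eq_on_derivable fg (f1 p Up).
- by move=> p Up; apply: eq_on_derivable fg (f2 p Up).
- by apply: IH cu => p Up; apply: eq_on_derive fg.
- by apply: IH cv => p Up; apply: eq_on_derive fg.
Qed.

(** Reduces the regularity of vector fields to that of real functions. *)
Lemma class_C_row n k U (F : R * R -> 'rV[R]_n) : open U ->
  class_C k U F <-> forall i, class_C k U (fun p => F p 0 i).
Proof.
move=> oU; elim: k F => [|k IH] F /=.
  split=> [cF i p Up|cF p Up].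
    apply: (@continuous_comp _ _ _ F (fun M => M 0 i) p (cF p Up)).
    exact: coord_continuous.
  apply/cvgrPdist_le => e e0; near=> q.
  rewrite /Num.Def.normr/= mx_normrE (bigmax_le _ (ltW e0))//= => -[i j] _.
  rewrite !mxE/= ord1; move: j; near: q; apply: filter_forall => j.
  exact: ((cvgrPdist_le _ _).1 (cF j p Up)).
have E p i w : derivable F p w -> 'D_w F p 0 i = 'D_w (fun p => F p 0 i) p.
  by move=> dF; rewrite derive_mx// mxE.
split=> [[d1 d2 cu cv] i|cF].
  split.
  - by move=> p Up; have /derivable_mxP := d1 p Up.
  - by move=> p Up; have /derivable_mxP := d2 p Up.
  - move/(IH _).1: cu => /(_ i) /(class_C_eq_on oU); apply => p Up.
    exact: (E _ _ _ (d1 p Up)).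
  - move/(IH _).1: cv => /(_ i) /(class_C_eq_on oU); apply => p Up.
    exact: (E _ _ _ (d2 p Up)).
have d1 p : U p -> derivable F p ((1, 0) : R * R).
  by move=> Up; apply/derivable_mxP => i j; rewrite ord1; have [+ _ _ _] := cF j; apply.
have d2 p : U p -> derivable F p ((0, 1) : R * R).
  by move=> Up; apply/derivable_mxP => i j; rewrite ord1; have [_ + _ _] := cF j; apply.
split; [exact: d1|exact: d2| |]; apply/(IH _).2 => i; have [_ _ cu cv] := cF i.
- by apply: (class_C_eq_on oU _ cu) => p Up; exact/esym/E/d1.
- by apply: (class_C_eq_on oU _ cv) => p Up; exact/esym/E/d2.
Unshelve. all: by end_near. Qed.

(** Not immediate from the definition, which asserts continuity at the top order only: the base case
    is the continuity of a function with continuous partials. *)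
Lemma class_CW k U (f : R * R -> R) : open U ->
  class_C k.+1 U f -> class_C k U f.
Proof.
move=> oU; elim: k f => [|k IH] f.
  case=> d1 d2 cu cv p Up; apply: partials_continuous; [|exact: cu|exact: cv].
  by apply: filterS (near_open oU Up) => q Uq; split; [exact: d1|exact: d2].
by case=> d1 d2 cu cv; split; [exact: d1|exact: d2|exact: (IH _ cu)|exact: (IH _ cv)].
Qed.

Lemma class_C_rowW n k U (F : R * R -> 'rV[R]_n) : open U ->
  class_C k.+1 U F -> class_C k U F.
Proof.
by move=> oU /(class_C_row _ _ oU) cF; apply/(class_C_row _ _ oU) => i; apply: class_CW.
Qed.

Lemma class_C_cst V k U (c : V) : class_C k U (fun=> c).
Proof.
elim: k c => [|k IH] c /=; first by move=> p Up; exact: cvg_cst.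
have E w : 'D_w (fun=> c) = (fun=> 0 : V) :> (R * R -> V).
  by apply/funext => p; exact: derive_cst.
by split; rewrite /du /dv ?E// => p Up; exact: derivable_cst.
Qed.

Lemma class_CD k U (f g : R * R -> R) : open U ->
  class_C k U f -> class_C k U g -> class_C k U (fun p => f p + g p).
Proof.
move=> oU; elim: k f g => [|k IH] f g /=.
  by move=> cf cg p Up; apply: cvgD; [exact: cf|exact: cg].
case=> f1 f2 fu fv [g1 g2 gu gv]; split.
- by move=> p Up; apply: derivableD; [exact: f1|exact: g1].
- by move=> p Up; apply: derivableD; [exact: f2|exact: g2].
- apply: (class_C_eq_on oU _ (IH _ _ fu gu)) => p Up.
  exact/esym/(deriveD (f1 p Up) (g1 p Up)).
- apply: (class_C_eq_on oU _ (IH _ _ fv gv)) => p Up.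
  exact/esym/(deriveD (f2 p Up) (g2 p Up)).
Qed.

(** The product rule brings back [f] and [g] undifferentiated, so the induction has to lower their
    class by [class_CW]. The same happens for inverses and square roots. *)
Lemma class_CM k U (f g : R * R -> R) : open U ->
  class_C k U f -> class_C k U g -> class_C k U (fun p => f p * g p).
Proof.
move=> oU; elim: k f g => [|k IH] f g cf cg.
  by move=> p Up; apply: cvgM; [exact: cf|exact: cg].
have cf' := class_CW oU cf; have cg' := class_CW oU cg.
move: cf cg => [f1 f2 fu fv] [g1 g2 gu gv]; split.
- by move=> p Up; apply: derivableM; [exact: f1|exact: g1].
- by move=> p Up; apply: derivableM; [exact: f2|exact: g2].
- apply: (class_C_eq_on oU _ (class_CD oU (IH _ _ cf' gu) (IH _ _ cg' fu))) => p Up.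
  exact/esym/(deriveM (f1 p Up) (g1 p Up)).
- apply: (class_C_eq_on oU _ (class_CD oU (IH _ _ cf' gv) (IH _ _ cg' fv))) => p Up.
  exact/esym/(deriveM (f2 p Up) (g2 p Up)).
Qed.

Lemma class_CV k U (f : R * R -> R) : open U -> (forall p, U p -> f p != 0) ->
  class_C k U f -> class_C k U (fun p => (f p)^-1).
Proof.
move=> oU f0; elim: k => [|k IH] cf.
  by move=> p Up; apply: cvgV; [exact: f0|exact: cf].
have cV := IH (class_CW oU cf).
(* The factor - f^-2 of the derivative, of class C^k by the induction hypothesis on the inverse
   itself. *)
have cV2 := class_CM oU (class_C_cst k U (- 1 : R)) (class_CM oU cV cV).
move: cf => [f1 f2 fu fv]; split.
- by move=> p Up; apply: derivableV; [exact: f0|exact: f1].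
- by move=> p Up; apply: derivableV; [exact: f0|exact: f2].
- apply: (class_C_eq_on oU _ (class_CM oU cV2 fu)) => p Up.
  rewrite [RHS](deriveV (f0 p Up) (f1 p Up)).
  by rewrite mulN1r -expr2 -exprVn.
- apply: (class_C_eq_on oU _ (class_CM oU cV2 fv)) => p Up.
  rewrite [RHS](deriveV (f0 p Up) (f2 p Up)).
  by rewrite mulN1r -expr2 -exprVn.
Qed.

Lemma is_derive_sqrt_comp V (f : V -> R) (p w : V) (df : R) :
  0 < f p -> is_derive p w f df ->
  is_derive p w (fun q => Num.sqrt (f q)) ((2 * Num.sqrt (f p))^-1 * df).
Proof.
move=> f0 fd; have [s1 s2] := is_derive1_sqrt f0.
have ds : differentiable (@Num.sqrt R) (f p) by apply/derivable1_diffP.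
apply: is_derive_eq (is_derive_comp fd ds) _.
by rewrite diff1E// derive1E s2 [RHS]mulrC.
Qed.

Lemma class_C_sqrt k U (f : R * R -> R) : open U -> (forall p, U p -> 0 < f p) ->
  class_C k U f -> class_C k U (fun p => Num.sqrt (f p)).
Proof.
move=> oU f0; elim: k => [|k IH] cf.
  move=> p Up; apply: (@continuous_comp _ _ _ f (@Num.sqrt R) p (cf p Up)).
  exact: sqrt_continuous.
have cs := class_CM oU (class_C_cst k U (2 : R)) (IH (class_CW oU cf)).
have cV := class_CV oU _ cs.
move: cf => [f1 f2 fu fv].
have D w p : U p -> derivable f p w -> is_derive p w (fun q => Num.sqrt (f q))
    ((2 * Num.sqrt (f p))^-1 * 'D_w f p).
  by move=> Up fw; apply: is_derive_sqrt_comp; [exact: f0|exact: derivableP].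
have cV' : class_C k U (fun p => (2 * Num.sqrt (f p))^-1).
  by apply: cV => p Up; rewrite mulf_neq0// gt_eqF// sqrtr_gt0 f0.
split.
- by move=> p Up; have [] := D _ _ Up (f1 p Up).
- by move=> p Up; have [] := D _ _ Up (f2 p Up).
- apply: (class_C_eq_on oU _ (class_CM oU cV' fu)) => p Up.
  have [_ e] := D _ _ Up (f1 p Up); exact: esym e.
- apply: (class_C_eq_on oU _ (class_CM oU cV' fv)) => p Up.
  have [_ e] := D _ _ Up (f2 p Up); exact: esym e.
Qed.

Lemma class_C_sum k U (I : Type) (r : seq I) (F : I -> R * R -> R) : open U ->
  (forall i, class_C k U (F i)) -> class_C k U (fun p => \sum_(i <- r) F i p).
Proof.
move=> oU cF; elim: r => [|i r IH].
  by apply: (class_C_eq_on oU _ (class_C_cst k U (0 : R))) => p Up; rewrite big_nil.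
by apply: (class_C_eq_on oU _ (class_CD oU (cF i) IH)) => p Up; rewrite big_cons.
Qed.

Lemma class_C_prod k U (I : Type) (r : seq I) (F : I -> R * R -> R) : open U ->
  (forall i, class_C k U (F i)) -> class_C k U (fun p => \prod_(i <- r) F i p).
Proof.
move=> oU cF; elim: r => [|i r IH].
  by apply: (class_C_eq_on oU _ (class_C_cst k U (1 : R))) => p Up; rewrite big_nil.
by apply: (class_C_eq_on oU _ (class_CM oU (cF i) IH)) => p Up; rewrite big_cons.
Qed.

Lemma class_C_dot k U (F G : R * R -> 'rV[R]_4) : open U ->
  class_C k U F -> class_C k U G -> class_C k U (fun p => dot (F p) (G p)).
Proof.
move=> oU /(class_C_row _ _ oU) cF /(class_C_row _ _ oU) cG.
apply: (class_C_sum _ (F := fun i p => F p 0 i * G p 0 i) oU) => i.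
exact: (class_CM oU (cF i) (cG i)).
Qed.

Lemma class_CZ n k U (a : R * R -> R) (F : R * R -> 'rV[R]_n) : open U ->
  class_C k U a -> class_C k U F -> class_C k U (fun p => a p *: F p).
Proof.
move=> oU ca /(class_C_row _ _ oU) cF; apply/(class_C_row _ _ oU) => i.
by apply: (class_C_eq_on oU _ (class_CM oU ca (cF i))) => p Up; rewrite mxE.
Qed.

Lemma class_C_rowB n k U (F G : R * R -> 'rV[R]_n) : open U ->
  class_C k U F -> class_C k U G -> class_C k U (fun p => F p - G p).
Proof.
move=> oU /(class_C_row _ _ oU) cF /(class_C_row _ _ oU) cG.
apply/(class_C_row _ _ oU) => i.
have cN := class_CM oU (class_C_cst k U (-1 : R)) (cG i).
apply: (class_C_eq_on oU _ (class_CD oU (cF i) cN)) => p Up.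
by rewrite !mxE mulN1r.
Qed.

(** By the Leibniz formula each coordinate is a sum of products of coordinates of the factors. *)
Lemma class_C_tprod k U (F G H : R * R -> 'rV[R]_4) : open U ->
  class_C k U F -> class_C k U G -> class_C k U H ->
  class_C k U (fun p => tprod (F p) (G p) (H p)).
Proof.
move=> oU /(class_C_row _ _ oU) cF /(class_C_row _ _ oU) cG.
move=> /(class_C_row _ _ oU) cH.
apply/(class_C_row _ _ oU) => j.
have cdet (A : 'I_4 -> 'I_4 -> R * R -> R) : (forall i j, class_C k U (A i j)) ->
    class_C k U (fun p => \det (\matrix_(i, j) A i j p)).
  move=> cA; apply: (class_C_sum _ (F := fun s : 'S_4 => fun p =>
      (-1) ^+ s * \prod_i (\matrix_(i, j) A i j p) i (s i)) oU) => s.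
  apply: (class_CM oU).
    exact: class_C_cst.
  apply: (class_C_prod _ (F := fun i p => (\matrix_(i, j) A i j p) i (s i)) oU) => i.
  by apply: (class_C_eq_on oU _ (cA i (s i))) => p Up; rewrite mxE.
have := cdet (fun i l p => ([:: delta_mx 0 j; F p; G p; H p]`_i : 'rV[R]_4) 0 l).
move=> cA; apply: (class_C_eq_on oU _ (cA _)).
  by move=> p Up; rewrite mxE.
move=> [[|[|[|[|//]]]] /= _] l;
  [exact: class_C_cst|exact: cF|exact: cG|exact: cH].
Qed.

End calculus.

(** * Euclidean 4-space *)

Section frame_algebra.
Context {R : realType}.
Implicit Types x y z w : 'rV[R]_4.

(** Expansion along the first row over arrays indexed by [nat]: it unfolds by computation, which the
    sum over permutations behind [\det] does not. [bump j] skips column [j]. *)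
Fixpoint laplace_det n (f : nat -> nat -> R) : R :=
  if n is m.+1 then \sum_(j < m.+1) f 0%N j *
    ((-1) ^+ j * laplace_det m (fun i k => f i.+1 (bump j k)))
  else 1.

Lemma det_laplace n (f : nat -> nat -> R) :
  \det (\matrix_(i < n, j < n) f i j) = laplace_det n f.
Proof.
elim: n f => [|n IH] f; first exact: det_mx00.
rewrite (expand_det_row _ ord0); apply: eq_bigr => j _; rewrite mxE /cofactor.
rewrite [in RHS]/= -/(laplace_det n _) -IH.
by congr (_ * (_ * \det _)); apply/matrixP => i k; rewrite !mxE.
Qed.

Lemma row4P x y : x 0 0 = y 0 0 -> x 0 1 = y 0 1 -> x 0 2 = y 0 2 ->
  x 0 3 = y 0 3 -> x = y.
Proof.
move=> e0 e1 e2 e3; apply/rowP => -[[|[|[|[|//]]]] i].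
- by move: e0; congr (x 0 _ = y 0 _); apply/val_inj.
- by move: e1; congr (x 0 _ = y 0 _); apply/val_inj.
- by move: e2; congr (x 0 _ = y 0 _); apply/val_inj.
- by move: e3; congr (x 0 _ = y 0 _); apply/val_inj.
Qed.

Lemma dotE x y : dot x y = x 0 0 * y 0 0 + x 0 1 * y 0 1 + x 0 2 * y 0 2 + x 0 3 * y 0 3.
Proof.
rewrite /dot !big_ord_recl big_ord0 addr0 !addrA.
by congr (x 0 _ * y 0 _ + x 0 _ * y 0 _ + x 0 _ * y 0 _ + x 0 _ * y 0 _); apply/val_inj.
Qed.

(** The 3 x 3 minor on the columns [a], [b], [c], expanded along [x]. *)
Definition minor3 (a b c : 'I_4) x y z :=
  x 0 a * (y 0 b * z 0 c - y 0 c * z 0 b) - x 0 b * (y 0 a * z 0 c - y 0 c * z 0 a)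
  + x 0 c * (y 0 a * z 0 b - y 0 b * z 0 a).

(** The coordinates are the cofactors of the first row, whence the alternating signs. From here on
    identities about [tprod] are polynomial and within reach of [ring]. *)
Lemma tprodE x y z :
  (tprod x y z 0 0 = minor3 1 2 3 x y z) * (tprod x y z 0 1 = - minor3 0 2 3 x y z) *
  (tprod x y z 0 2 = minor3 0 1 3 x y z) * (tprod x y z 0 3 = - minor3 0 1 2 x y z).
Proof.
pose f (l : 'I_4) (i j : nat) : R :=
  ([:: delta_mx 0 l; x; y; z]`_i : 'rV_4) 0 (inord j).
have E l : tprod x y z 0 l = \det (\matrix_(i < 4, j < 4) f l i j).
  rewrite mxE; congr (\det _); apply/matrixP => i j; rewrite !mxE /f.
  by rewrite inord_val.
have i0 : inord 0 = 0 :> 'I_4 by apply/val_inj; rewrite /= inordK.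
have i1 : inord 1 = 1 :> 'I_4 by apply/val_inj; rewrite /= inordK.
have i2 : inord 2 = 2 :> 'I_4 by apply/val_inj; rewrite /= inordK.
have i3 : inord 3 = 3 :> 'I_4 by apply/val_inj; rewrite /= inordK.
split; [split; [split|]|]; rewrite E det_laplace /= !big_ord_recl !big_ord0 /=;
 rewrite /f /= /bump /= !add1n i0 i1 i2 i3 !mxE /= /minor3; ring.
Qed.

Lemma dotC x y : dot x y = dot y x.
Proof. by rewrite !dotE; ring. Qed.

Lemma dotDl x y z : dot (x + y) z = dot x z + dot y z.
Proof. by rewrite !dotE !mxE; ring. Qed.

Lemma dotZl (a : R) x y : dot (a *: x) y = a * dot x y.
Proof. by rewrite !dotE !mxE; ring. Qed.

Lemma dotNl x y : dot (- x) y = - dot x y.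
Proof. by rewrite !dotE !mxE; ring. Qed.

Lemma dotDr x y z : dot x (y + z) = dot x y + dot x z.
Proof. by rewrite !dotE !mxE; ring. Qed.

Lemma dotZr (a : R) x y : dot x (a *: y) = a * dot x y.
Proof. by rewrite !dotE !mxE; ring. Qed.

Lemma dotNr x y : dot x (- y) = - dot x y.
Proof. by rewrite !dotE !mxE; ring. Qed.

Lemma dot_tprod x y z :
  (dot (tprod x y z) x = 0) * (dot (tprod x y z) y = 0) * (dot (tprod x y z) z = 0).
Proof. by rewrite !dotE !tprodE /minor3; split; [split|]; ring. Qed.

(** The right-hand side is the Gram determinant of the three vectors; on an orthonormal triple it is
    1, which makes [D] a unit vector. *)
Lemma lagrange_tprod x y z : dot (tprod x y z) (tprod x y z) =
  dot x x * (dot y y * dot z z - dot y z ^+ 2)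
  - dot x y * (dot x y * dot z z - dot y z * dot x z)
  + dot x z * (dot x y * dot y z - dot y y * dot x z).
Proof. by rewrite !dotE !tprodE /minor3; ring. Qed.

(* Shape of [tprod T T_u T_uu] when [T_u] is normal: [y = N], [x = T], [z = E]. *)
Lemma tprod_comb x y z (a b c d : R) :
  tprod x (a *: y) (b *: y + c *: x + d *: z) = - (a * d) *: tprod y x z.
Proof. by apply: row4P; rewrite [RHS]mxE !tprodE /minor3 !mxE; ring. Qed.

Lemma dot_ge0 x : 0 <= dot x x.
Proof. by apply: sumr_ge0 => i _; rewrite -expr2 sqr_ge0. Qed.

Lemma dot_eq0 x : (dot x x == 0) = (x == 0).
Proof.
apply/eqP/eqP => [|->]; last by rewrite -(scale0r 0) dotZl mul0r.
move=> /psumr_eq0P x0; apply/rowP => i; rewrite mxE; apply/eqP.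
by rewrite -sqrf_eq0 expr2 x0// => j _; rewrite -expr2 sqr_ge0.
Qed.

Lemma dot_gt0 x : x != 0 -> 0 < dot x x.
Proof. by move=> x0; rewrite lt0r dot_eq0 x0 dot_ge0. Qed.

Lemma enorm_sqr x : enorm x ^+ 2 = dot x x.
Proof. by rewrite sqr_sqrtr// dot_ge0. Qed.

Lemma enorm_gt0 x : x != 0 -> 0 < enorm x.
Proof. by move=> x0; rewrite sqrtr_gt0 dot_gt0. Qed.

Lemma dot_normalized x : x != 0 ->
  dot ((enorm x)^-1 *: x) ((enorm x)^-1 *: x) = 1.
Proof.
move=> x0; rewrite dotZl dotZr -enorm_sqr; field.
by rewrite gt_eqF// enorm_gt0.
Qed.

(** Orthonormality says A A^T = 1; as [A] is square this gives A^T A = 1 too, and x = (x A^T) A is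
    the expansion. *)
Lemma orthonormal_expansion (e : 'I_4 -> 'rV[R]_4) x :
  (forall i j, dot (e i) (e j) = (i == j)%:R) ->
  x = \sum_i dot x (e i) *: e i.
Proof.
move=> eO; pose A : 'M[R]_4 := \matrix_i e i.
have AAT : A *m A^T = 1%:M.
  apply/matrixP => i j; rewrite !mxE -eO; apply: eq_bigr => k _.
  by rewrite !mxE.
rewrite -{1}[x]mulmx1 -(mulmx1C AAT) mulmxA mulmx_sum_row.
apply: eq_bigr => i _; rewrite rowK; congr (_ *: _).
by rewrite mxE; apply: eq_bigr => j _; rewrite !mxE.
Qed.

Lemma frame_expansion t e d n x :
  dot t t = 1 -> dot e e = 1 -> dot d d = 1 -> dot n n = 1 ->
  dot t e = 0 -> dot t d = 0 -> dot t n = 0 ->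
  dot e d = 0 -> dot e n = 0 -> dot d n = 0 ->
  x = dot x t *: t + dot x e *: e + dot x d *: d + dot x n *: n.
Proof.
move=> tt ee dd nn te td tn ed en dn.
rewrite {1}(@orthonormal_expansion (fun i => [:: t; e; d; n]`_i) x).
  by rewrite !big_ord_recl big_ord0 addr0 !addrA.
by move=> [[|[|[|[|//]]]] ?] [[|[|[|[|//]]]] ?]; rewrite //= dotC.
Qed.

End frame_algebra.

(** * Derivation rules for products, inner products and scaled fields *)

Section derive_rules.
Context {R : realType} {V : normedModType R}.
Implicit Types (p w : V) (a b : V -> R) (F G : V -> 'rV[R]_4).

Lemma is_derive_rowP n (F : V -> 'rV[R]_n) p w (dF : 'rV[R]_n) :
  is_derive p w F dF <->
  forall i, is_derive p w (fun q => F q 0 i) (dF 0 i).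
Proof.
split=> [[d1 d2] i|dF_].
  split; first by have /derivable_mxP := d1.
  by rewrite -d2 derive_mx// mxE.
have d1 : derivable F p w.
  by apply/derivable_mxP => i j; rewrite ord1; have [] := dF_ j.
split=> //; rewrite derive_mx//; apply/rowP => i; rewrite mxE.
by have [] := dF_ i.
Qed.

Lemma is_derive_mul a b p w (da db : R) :
  is_derive p w a da -> is_derive p w b db ->
  is_derive p w (fun q => a q * b q) (da * b p + a p * db).
Proof.
move=> ha hb; apply: is_derive_eq (is_deriveM ha hb) _.
by rewrite addrC [b p *: da]mulrC.
Qed.

Lemma is_derive_add a b p w (da db : R) :
  is_derive p w a da -> is_derive p w b db ->
  is_derive p w (fun q => a q + b q) (da + db).
Proof. exact: is_deriveD. Qed.

Lemma is_derive_inv a p w (da : R) : a p != 0 ->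
  is_derive p w a da -> is_derive p w (fun q => (a q)^-1) (- (a p ^- 2 * da)).
Proof.
move=> a0 [d1 <-]; split; first exact: derivableV.
by rewrite deriveV// scaleNr.
Qed.

Lemma is_derive_dot F G p w dF dG :
  is_derive p w F dF -> is_derive p w G dG ->
  is_derive p w (fun q => dot (F q) (G q)) (dot dF (G p) + dot (F p) dG).
Proof.
move=> /is_derive_rowP hF /is_derive_rowP hG.
have := is_derive_sum (fun i => is_derive_mul (hF i) (hG i)).
by rewrite big_split; congr is_derive; apply/funext => q; rewrite fct_sumE.
Qed.

Lemma is_derive_scale n a (F : V -> 'rV[R]_n) p w (da : R) dF :
  is_derive p w a da -> is_derive p w F dF ->
  is_derive p w (fun q => a q *: F q) (da *: F p + a p *: dF).
Proof.
move=> ha /is_derive_rowP hF; apply/is_derive_rowP => i.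
have := is_derive_mul ha (hF i).
rewrite !mxE; congr is_derive; apply/funext => q; rewrite mxE//.
Qed.

End derive_rules.

Lemma row_derive (R : realType) (V : normedModType R) n (F : V -> 'rV[R]_n)
    (p w : V) i :
  derivable F p w -> 'D_w F p 0 i = 'D_w (fun q => F q 0 i) p.
Proof. by move=> dF; rewrite derive_mx// mxE. Qed.

(** * Mixed partials of fields and differentiation of inner product identities on an open set *)

Section smooth_fields.
Context {R : realType} (U : set (R * R)) (openU : open U).
Implicit Types (p : R * R).

Lemma class_C_is_derive_u k (V : normedModType R) (F : R * R -> V) p :
  class_C k.+1 U F -> U p -> is_derive p ((1, 0) : R * R) F (du F p).
Proof. by case=> dF _ _ _ Up; apply: derivableP; exact: dF. Qed.

Lemma class_C_is_derive_v k (V : normedModType R) (F : R * R -> V) p :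
  class_C k.+1 U F -> U p -> is_derive p ((0, 1) : R * R) F (dv F p).
Proof. by case=> _ dF _ _ Up; apply: derivableP; exact: dF. Qed.

Lemma class_C_du k (V : normedModType R) (F : R * R -> V) :
  class_C k.+1 U F -> class_C k U (du F).
Proof. by case. Qed.

Lemma class_C_dv k (V : normedModType R) (F : R * R -> V) :
  class_C k.+1 U F -> class_C k U (dv F).
Proof. by case. Qed.

Lemma dv_du n (F : R * R -> 'rV[R]_n) p :
  class_C 2 U F -> U p -> dv (du F) p = du (dv F) p.
Proof.
move=> cF Up; apply/rowP => i.
have cFu := class_C_du cF; have cFv := class_C_dv cF.
have [_ dvu _ _] := cFu; have [duv _ _ _] := cFv.
rewrite [LHS](row_derive i (dvu p Up)) [RHS](row_derive i (duv p Up)).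
have [du1 dv1 _ _] := cF.
(* Taking a coordinate commutes with the inner derivative only at points of [U], hence the passage
   through [eq_on_derive]. *)
rewrite (eq_on_derive (g := du (fun q => F q 0 i)) _ openU Up); last first.
  by move=> q Uq; exact: row_derive (du1 q Uq).
rewrite [RHS](eq_on_derive (g := dv (fun q => F q 0 i)) _ openU Up); last first.
  by move=> q Uq; exact: row_derive (dv1 q Uq).
have cFi := (class_C_row _ _ openU).1 cF i.
move: cFi => [d1 d2 [_ d12 _ c12] [d21 _ c21 _]].
apply: derive_comm; [|exact: c12|exact: c21].
apply: filterS (near_open openU Up) => q Uq.
by split; [exact: d1|exact: d2|exact: d12|exact: d21].
Qed.

Lemma dot_eq_derive (F G : R * R -> 'rV[R]_4) (a : R * R -> R) p w dF dG da :
  U p -> (forall q, U q -> dot (F q) (G q) = a q) ->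
  is_derive p w F dF -> is_derive p w G dG -> is_derive p w a da ->
  dot dF (G p) + dot (F p) dG = da.
Proof.
move=> Up FGa hF hG [_ <-]; have [_ <-] := is_derive_dot hF hG.
exact: eq_on_derive openU Up FGa.
Qed.

Lemma dot_cst_derive (F G : R * R -> 'rV[R]_4) (c : R) p w dF dG : U p ->
  (forall q, U q -> dot (F q) (G q) = c) ->
  is_derive p w F dF -> is_derive p w G dG ->
  dot dF (G p) + dot (F p) dG = 0.
Proof.
by move=> Up FGc hF hG; exact: dot_eq_derive Up FGc hF hG (is_derive_cst _ _ _).
Qed.

End smooth_fields.

(** * Unit normal and tangent vectors of a hypersurface *)

Section hypersurface.
Context {R : realType}.

Lemma diff_grad (f : 'rV[R]_4 -> R) (x v : 'rV[R]_4) :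
  differentiable f x -> 'd f x v = dot v (grad f x).
Proof.
move=> df; rewrite {1}[v]row_sum_delta linear_sum; apply: eq_bigr => i _.
by rewrite linearZ mxE deriveE.
Qed.

Lemma hypersurface_normal (M : set 'rV[R]_4) (nu : 'rV[R]_4 -> 'rV[R]_4) x :
  oriented_hypersurface M nu -> M x -> dot (nu x) (nu x) = 1.
Proof.
move=> oM Mx; have [W [f [_ Wx fW _ nuW]]] := oM x Mx.
by rewrite nuW// dot_normalized//; have [] := fW x Wx.
Qed.

(** The local equation [f] vanishes along the curve, and the derivative of [f] along it is the inner
    product of the velocity with the gradient, of which [nu] is a multiple. *)
Lemma hypersurface_tangent (M : set 'rV[R]_4) (nu : 'rV[R]_4 -> 'rV[R]_4)
    (g : R -> 'rV[R]_4) (t : R) (dg : 'rV[R]_4) :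
  oriented_hypersurface M nu -> (\forall s \near t, M (g s)) ->
  is_derive t 1 g dg -> dot dg (nu (g t)) = 0.
Proof.
move=> oM Mg hg; have Mt := nbhs_singleton Mg.
have [W [f [oW Wt fW fM nuW]]] := oM _ Mt.
have [df _ _] := fW _ Wt.
rewrite nuW// dotZr -diff_grad//.
have [hfg1 <-] := is_derive_comp hg df.
have cg : {for t, continuous g}.
  by apply/differentiable_continuous/derivable1_diffP; case: hg.
have Wg : \forall s \near t, W (g s) by apply: cg; exact: near_open oW Wt.
rewrite (near_eq_derive (g := cst 0)) ?derive_cst ?mulr0//.
by apply: filterS2 Mg Wg => s Ms Ws; exact/fM.
Qed.

End hypersurface.

(** * The ED^2-frame in the direction u *)

Section ED2_frame.
Context {R : realType} (U : set (R * R)) (Omega N : R * R -> 'rV[R]_4).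
Hypotheses (openU : open U) (smoothOmega : class_C 7 U Omega)
  (smoothN : class_C 7 U N) (frame : is_ED2_frame_field Omega N U)
  (kappa_neq0 : forall p, U p -> normal_curvature Omega N p != 0).
Implicit Types p : R * R.

Let T := ED2_T Omega.
Let E := ED2_E Omega N.
Let D := ED2_D Omega N.
Let kappa := normal_curvature Omega N.
Let sigma := geodesic_curvature2 Omega N.
Let tau := geodesic_torsion1 Omega N.

Lemma class_C_ED2_T : class_C 6 U T. Proof. exact: class_C_du smoothOmega. Qed.

Lemma class_C_ED2_kappa : class_C 5 U kappa.
Proof.
apply: (class_C_dot openU (class_C_du class_C_ED2_T)).
exact: (class_C_rowW openU (class_C_rowW openU smoothN)).
Qed.

Lemma class_C_ED2_perp : class_C 4 U (ED2_perp Omega N).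
Proof.
have cO3 := class_C_du (class_C_du class_C_ED2_T).
have cN : class_C 4 U N by do 3 apply: (class_C_rowW openU).
have cT : class_C 4 U T by do 2 apply: (class_C_rowW openU); exact: class_C_ED2_T.
apply: (class_C_rowB openU (F := fun p => _ - _)).
  apply: (class_C_rowB openU cO3).
  exact: (class_CZ openU (class_C_dot openU cO3 cN) cN).
exact: (class_CZ openU (class_C_dot openU cO3 cT) cT).
Qed.

Lemma class_C_ED2_E : class_C 4 U E.
Proof.
have perp0 : forall p, U p -> ED2_perp Omega N p != 0 by case: frame.
apply: (class_CZ openU _ class_C_ED2_perp); apply: (class_CV openU).
  by move=> p Up; rewrite gt_eqF// enorm_gt0// perp0.
apply: (class_C_sqrt openU) (class_C_dot openU class_C_ED2_perp class_C_ED2_perp).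
by move=> p Up; rewrite dot_gt0// perp0.
Qed.

Lemma class_C_ED2_D : class_C 4 U D.
Proof.
apply: (class_C_tprod openU _ _ class_C_ED2_E); first by do 3 apply: (class_C_rowW openU).
by do 2 apply: (class_C_rowW openU); exact: class_C_ED2_T.
Qed.

Lemma class_C_ED2_sigma : class_C 3 U sigma.
Proof.
exact: (class_C_dot openU (class_C_du class_C_ED2_E) (class_C_rowW openU class_C_ED2_D)).
Qed.

Lemma class_C_ED2_tau : class_C 3 U tau.
Proof.
apply: (class_C_dot openU (class_C_du class_C_ED2_E)).
by do 4 apply: (class_C_rowW openU).
Qed.

Lemma dotNN p : U p -> dot (N p) (N p) = 1.
Proof.
case: frame => hyp _ _ _ Up; case: p Up => u v Up.
have [M [nu [oM MN]]] := hyp v; have [Mp ->] := MN u Up.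
exact: hypersurface_normal oM Mp.
Qed.

Lemma dotTN p : U p -> dot (T p) (N p) = 0.
Proof.
case: frame => hyp _ _ _ Up.
have [M [nu [oM MN]]] := hyp p.2.
(* The hypersurface depends on v, so the curve must keep the second coordinate of [p] for a single
   [M] to serve. *)
pose g (h : R) := h *: ((1, 0) : R * R) + p.
have gE h : g h = (h + p.1, p.2).
  by rewrite /g; case: (p) => u v; congr pair; rewrite /= ?[h *: 1]mulr1 ?scaler0 ?add0r.
have g0 : g 0 = p by rewrite /g scale0r add0r.
have [_ Np] : M (Omega p) /\ N p = nu (Omega p).
  by move: (Up); rewrite -g0 gE add0r; exact: MN.
have /is_derive_lineP hT := class_C_is_derive_u smoothOmega Up.
rewrite Np -{2}g0; apply: (hypersurface_tangent oM _ hT).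
have cg : {for 0, continuous g}.
  apply: cvgD; last exact: cvg_cst.
  by apply: cvgZr_tmp; exact: cvg_id.
have : \forall h \near (0 : R), U (g h).
  by apply: cg; rewrite g0; exact: (near_open openU Up).
by apply: filterS => h; rewrite -/(g h) gE => /MN[].
Qed.

Lemma dotTT p : U p -> dot (T p) (T p) = 1.
Proof. by case: frame => _ uT _ _ Up; rewrite -enorm_sqr uT// expr1n. Qed.

Lemma du_ED2_T p : U p -> du T p = kappa p *: N p.
Proof.
move=> Up; have [_ _ /(_ p Up) dep _] := frame.
have hT := class_C_is_derive_u class_C_ED2_T Up.
have TuT : dot (du T p) (T p) = 0.
  by have := dot_cst_derive openU Up dotTT hT hT; rewrite [X in _ + X]dotC; lra.
(* [w] is orthogonal to both [N] and [T]. Were it nonzero, pairing a linear relation with [w], [T]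
   and [N] in turn would kill all its coefficients, against the assumed dependence. *)
set w := du T p - kappa p *: N p.
have wN : dot (N p) w = 0.
  by rewrite /w dotDr dotNr dotZr dotNN// mulr1 /kappa /normal_curvature dotC subrr.
have wT : dot (T p) w = 0.
  by rewrite /w dotDr dotNr dotZr dotTN// mulr0 subr0 dotC.
suff : w == 0 by rewrite subr_eq0 => /eqP.
apply: contraNT dep => w0.
apply/(@freeP _ _ _ [tuple N p; T p; du T p]) => k.
rewrite !big_ord_recl big_ord0 /= addr0 => k0.
have uE : du T p = w + kappa p *: N p by rewrite subrK.
have uw : dot (du T p) w = dot w w by rewrite uE dotDl dotZl wN mulr0 addr0.
have k2 : k (lift ord0 (lift ord0 ord0)) = 0.
  have := congr1 (fun x => dot x w) k0.
  rewrite !dotDl !dotZl wN wT uw !mulr0 !add0r -(scale0r w) dotZl mul0r.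
  by move/eqP; rewrite mulf_eq0 dot_eq0 (negbTE w0) orbF => /eqP.
have k1 : k (lift ord0 ord0) = 0.
  have := congr1 (fun x => dot x (T p)) k0.
  rewrite !dotDl !dotZl k2 dotTT// [dot (N p) _]dotC dotTN// -(scale0r w) dotZl; lra.
have k00 : k ord0 = 0.
  have := congr1 (fun x => dot x (N p)) k0.
  rewrite !dotDl !dotZl k2 dotNN// dotTN// -(scale0r w) dotZl; lra.
by move=> -[[|[|[|//]]] i]; [rewrite -k00|rewrite -k1|rewrite -k2];
  congr k; apply/val_inj.
Qed.

Lemma dot_duN_N p : U p -> dot (du N p) (N p) = 0.
Proof.
move=> Up; have hN := class_C_is_derive_u smoothN Up.
by have := dot_cst_derive openU Up dotNN hN hN; rewrite [X in _ + X]dotC; lra.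
Qed.

Lemma dot_duN_T p : U p -> dot (du N p) (T p) = - kappa p.
Proof.
move=> Up; have hN := class_C_is_derive_u smoothN Up.
have hT := class_C_is_derive_u class_C_ED2_T Up.
have := dot_cst_derive openU Up dotTN hT hN.
by rewrite du_ED2_T// dotZl dotNN// dotC; lra.
Qed.

Lemma du_du_ED2_T p : U p -> du (du T) p = du kappa p *: N p + kappa p *: du N p.
Proof.
move=> Up; have hN := class_C_is_derive_u smoothN Up.
have hk := class_C_is_derive_u class_C_ED2_kappa Up.
rewrite {1}/du (eq_on_derive (g := fun q => kappa q *: N q) _ openU Up du_ED2_T).
by have [_ ->] := is_derive_scale hk hN.
Qed.

(** The projection removes kappa_u N and the tangential part -kappa^2 T of Omega_uuu. What is left
    ties [E] to N_u, which is how N_u comes to lie in the span of [T] and [E]. *)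
Lemma ED2_perpE p : U p ->
  ED2_perp Omega N p = kappa p *: (du N p + kappa p *: T p).
Proof.
move=> Up.
have -> : ED2_perp Omega N p = du (du T) p - dot (du (du T) p) (N p) *: N p
   - dot (du (du T) p) (T p) *: T p by [].
rewrite du_du_ED2_T//.
rewrite !dotDl !dotZl dotNN// dot_duN_N// dot_duN_T// [dot (N p) _]dotC dotTN//.
by apply/rowP => i; rewrite !mxE; ring.
Qed.

Lemma ED2_perp_neq0 p : U p -> ED2_perp Omega N p != 0.
Proof. by case: frame => _ _ _; apply. Qed.

Lemma dotEE p : U p -> dot (E p) (E p) = 1.
Proof. by move=> Up; exact: dot_normalized (ED2_perp_neq0 Up). Qed.

Lemma dotTE p : U p -> dot (T p) (E p) = 0.
Proof.
move=> Up; rewrite dotZr ED2_perpE// dotZr dotDr dotZr dotTT//.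
rewrite [dot _ (du N p)]dotC dot_duN_T//.
by ring.
Qed.

Lemma dotEN p : U p -> dot (E p) (N p) = 0.
Proof.
move=> Up; rewrite dotZl ED2_perpE// dotZl dotDl dotZl dotTN// dot_duN_N//.
by ring.
Qed.

Lemma dotTD p : dot (T p) (D p) = 0.
Proof. by rewrite dotC dot_tprod. Qed.

Lemma dotED p : dot (E p) (D p) = 0.
Proof. by rewrite dotC dot_tprod. Qed.

Lemma dotDN p : dot (D p) (N p) = 0.
Proof. by rewrite dot_tprod. Qed.

Lemma dotDD p : U p -> dot (D p) (D p) = 1.
Proof.
move=> Up; rewrite lagrange_tprod dotNN// dotTT// dotEE// dotTE//.
by rewrite [dot (N p) (T p)]dotC [dot (N p) (E p)]dotC dotTN// dotEN//; ring.
Qed.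

Lemma ED2_expansion p x : U p -> x = dot x (T p) *: T p + dot x (E p) *: E p +
  dot x (D p) *: D p + dot x (N p) *: N p.
Proof.
by move=> Up; apply: frame_expansion;
  rewrite ?(dotTT, dotEE, dotDD, dotNN, dotTE, dotTD, dotTN, dotED, dotEN, dotDN).
Qed.

Lemma du_ED2_N p : U p -> du N p = - kappa p *: T p - tau p *: E p.
Proof.
move=> Up; have k0 := kappa_neq0 Up; have e0 := enorm_gt0 (ED2_perp_neq0 Up).
have hN := class_C_is_derive_u smoothN Up.
have hE := class_C_is_derive_u class_C_ED2_E Up.
(* Read off from |perp| E = perp = kappa (N_u + kappa T). Differentiating <E, N> = 0 then identifies
   [b] with -tau. *)
set b := enorm (ED2_perp Omega N p) / kappa p.
have NuE : du N p = - kappa p *: T p + b *: E p.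
  rewrite /E /ED2_E scalerA /b mulrAC divff ?gt_eqF// ED2_perpE// scalerA.
  by rewrite mul1r mulVf// scale1r scaleNr addrCA addNr addr0.
have -> : tau p = - b.
  have := dot_cst_derive openU Up dotEN hE hN.
  rewrite NuE dotDr (dotZr b) (dotZr (- _)) dotEE// [dot (E p) (T p)]dotC dotTE//.
  by rewrite /tau /geodesic_torsion1; lra.
by rewrite (scaleNr b) opprK NuE.
Qed.

(** The E-component vanishes by unit length and the T-component because T_u is normal; the other two
    are [sigma] and [tau] by definition. *)
Lemma du_ED2_E p : U p -> du E p = sigma p *: D p + tau p *: N p.
Proof.
move=> Up; have hE := class_C_is_derive_u class_C_ED2_E Up.
have hT := class_C_is_derive_u class_C_ED2_T Up.
have EuE : dot (du E p) (E p) = 0.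
  by have := dot_cst_derive openU Up dotEE hE hE; rewrite [X in _ + X]dotC; lra.
have EuT : dot (du E p) (T p) = 0.
  have := dot_cst_derive openU Up dotTE hT hE.
  by rewrite du_ED2_T// dotZl [dot (N p) _]dotC dotEN// dotC; lra.
by rewrite [LHS](ED2_expansion _ Up) EuE EuT !scale0r !add0r.
Qed.

Lemma du_ED2_D p : U p -> du D p = - sigma p *: E p.
Proof.
move=> Up; have hE := class_C_is_derive_u class_C_ED2_E Up.
have hT := class_C_is_derive_u class_C_ED2_T Up.
have hD := class_C_is_derive_u class_C_ED2_D Up.
have hN := class_C_is_derive_u smoothN Up.
have DuD : dot (du D p) (D p) = 0.
  by have := dot_cst_derive openU Up dotDD hD hD; rewrite [X in _ + X]dotC; lra.
have DuT : dot (du D p) (T p) = 0.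
  have := dot_cst_derive openU Up (fun q _ => dotTD q) hT hD.
  by rewrite du_ED2_T// dotZl [dot (N p) _]dotC dotDN// dotC; lra.
have DuE : dot (du D p) (E p) = - sigma p.
  have := dot_cst_derive openU Up (fun q _ => dotED q) hE hD.
  rewrite du_ED2_E// dotDl (dotZl (sigma _)) (dotZl (tau _)) dotDD//.
  by rewrite [dot (N p) _]dotC dotDN// dotC; lra.
have DuN : dot (du D p) (N p) = 0.
  have := dot_cst_derive openU Up (fun q _ => dotDN q) hD hN.
  rewrite du_ED2_N// dotDr dotNr (dotZr (tau _)) (dotZr (- _)).
  by rewrite ![dot (D p) _]dotC dotTD// dotED//; lra.
by rewrite [LHS](ED2_expansion _ Up) DuE DuT DuD DuN !scale0r add0r !addr0.
Qed.

Lemma Betchov_Da_Rios_D p : U p ->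
  tprod (du Omega p) (du (du Omega) p) (du (du (du Omega)) p) =
    (kappa p ^+ 2 * tau p) *: D p.
Proof.
move=> Up; have -> : du (du (du Omega)) p = du kappa p *: N p +
    - kappa p ^+ 2 *: T p + - (kappa p * tau p) *: E p.
  rewrite [LHS](du_du_ED2_T Up) du_ED2_N//.
  generalize (T p), (E p), (N p) => x y z.
  by apply/rowP => i; rewrite !mxE; ring.
(* By alternation only the E-component -kappa tau of Omega_uuu survives; with T_u = kappa N and the
   sign of the swap to N x T x E this leaves kappa^2 tau. *)
rewrite (du_ED2_T Up) tprod_comb; congr (_ *: _); ring.
Qed.

End ED2_frame.

(** * The ED^2-frame in the direction v *)

Section moving_frame.
Context {R : realType} (U : set (R * R)) (Omega E D N : R * R -> 'rV[R]_4)
  (kappa sigma tau : R * R -> R).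
Implicit Types p : R * R.
Let T := du Omega.
Hypotheses (openU : open U) (smoothOmega : class_C 3 U Omega)
  (smoothE : class_C 1 U E) (smoothD : class_C 1 U D) (smoothN : class_C 2 U N)
  (smooth_kappa : class_C 3 U kappa) (smooth_sigma : class_C 1 U sigma)
  (smooth_tau : class_C 3 U tau).
Hypotheses
  (TT : forall p, U p -> dot (T p) (T p) = 1)
  (EE : forall p, U p -> dot (E p) (E p) = 1)
  (DD : forall p, U p -> dot (D p) (D p) = 1)
  (NN : forall p, U p -> dot (N p) (N p) = 1)
  (TE : forall p, U p -> dot (T p) (E p) = 0)
  (TD : forall p, U p -> dot (T p) (D p) = 0)
  (TN : forall p, U p -> dot (T p) (N p) = 0)
  (ED : forall p, U p -> dot (E p) (D p) = 0)
  (EN : forall p, U p -> dot (E p) (N p) = 0)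
  (DN : forall p, U p -> dot (D p) (N p) = 0).
Hypotheses
  (duT : forall p, U p -> du T p = kappa p *: N p)
  (duE : forall p, U p -> du E p = sigma p *: D p + tau p *: N p)
  (duD : forall p, U p -> du D p = - sigma p *: E p)
  (duN : forall p, U p -> du N p = - kappa p *: T p - tau p *: E p)
  (dvOmega : forall p, U p -> dv Omega p = (kappa p ^+ 2 * tau p) *: D p)
  (kappa_neq0 : forall p, U p -> kappa p != 0)
  (tau_neq0 : forall p, U p -> tau p != 0).

(** The coefficients are kept as functions because [f12], [f13] and [f34] are themselves
    differentiated in u at the next round. *)
Let f12 p := - (kappa p ^+ 2 * tau p * sigma p).
Let f13 p := kappa p * (2 * tau p * du kappa p + kappa p * du tau p).
Let f24 p := 2 * kappa p * sigma p * du tau p +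
  tau p * (kappa p * du sigma p + 4 * sigma p * du kappa p).
Let f34 p := 1 / kappa p *
    ((kappa p * tau p * sigma p ^+ 2 - 4 * du kappa p * du tau p -
      kappa p * du (du tau) p) * kappa p
     - 2 * (du kappa p ^+ 2 + kappa p * du (du kappa) p) * tau p).
Let f23 p := -1 / (tau p * kappa p ^+ 2) *
    (- (3 * kappa p ^+ 3 * tau p * sigma p * du sigma p)
     + kappa p ^+ 5 * du tau p + 2 * kappa p ^+ 4 * tau p * du kappa p
     - 2 * tau p * du kappa p ^+ 3
     - kappa p ^+ 2 * sigma p ^+ 2 * (3 * kappa p * du tau p + 5 * tau p * du kappa p)
     + 2 * kappa p * du kappa p * (du kappa p * du tau p + 2 * tau p * du (du kappa) p)
     + kappa p ^+ 3 * du (du (du tau)) p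
     + kappa p ^+ 2 * (5 * du kappa p * du (du tau) p + 6 * du tau p * du (du kappa) p
       + 2 * tau p * du (du (du kappa)) p)).

Let smoothT : class_C 2 U T. Proof. exact: class_C_du smoothOmega. Qed.

(* Equality of mixed partials, read off against [G]: an unknown v-coefficient of
   [G] in terms of the known coefficients [c] of [F_u] and [a] of [F_v]. *)
Lemma mixed_coef (F G : R * R -> 'rV[R]_4) (c : R) (a : R * R -> R) (da : R) p :
  class_C 2 U F -> class_C 1 U G ->
  (forall q, U q -> dot (du F q) (G q) = c) ->
  (forall q, U q -> dot (dv F q) (G q) = a q) ->
  is_derive p ((1, 0) : R * R) a da -> U p ->
  dot (dv G p) (du F p) = dot (dv F p) (du G p) - da.
Proof.
move=> cF cG hc ha hda Up.
(* [x] and [x'] stand for <F_uv, G> and <F_vu, G>, [y] for <F_u, G_v>, [z] for <F_v, G_u> and [d]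
   for [da]. *)
have aux (x x' y z d : R) : x + y = 0 -> x' + z = d -> x = x' -> y = z - d.
  move=> /eqP; rewrite addrC addr_eq0 => /eqP -> <- ->.
  by rewrite opprD addrCA subrr addr0.
rewrite dotC; apply: aux
  (dot_cst_derive openU Up hc (class_C_is_derive_v (class_C_du cF) Up)
    (class_C_is_derive_v cG Up))
  (dot_eq_derive openU Up ha (class_C_is_derive_u (class_C_dv cF) Up)
    (class_C_is_derive_u cG Up) hda)
  (congr1 (fun x => dot x (G p)) (dv_du openU cF Up)).
Qed.

Let hTv p : U p -> is_derive p ((0, 1) : R * R) T (dv T p).
Proof. exact: class_C_is_derive_v smoothT. Qed.
Let hEv p : U p -> is_derive p ((0, 1) : R * R) E (dv E p).
Proof. exact: class_C_is_derive_v smoothE. Qed.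
Let hDv p : U p -> is_derive p ((0, 1) : R * R) D (dv D p).
Proof. exact: class_C_is_derive_v smoothD. Qed.
Let hNv p : U p -> is_derive p ((0, 1) : R * R) N (dv N p).
Proof. exact: class_C_is_derive_v smoothN. Qed.

Lemma dot_unit_dv F p : (forall q, U q -> dot (F q) (F q) = 1) ->
  is_derive p ((0, 1) : R * R) F (dv F p) -> U p -> dot (dv F p) (F p) = 0.
Proof.
move=> FF hF Up; have := dot_cst_derive openU Up FF hF hF.
by rewrite [X in _ + X]dotC; lra.
Qed.

Lemma dot_orth_dv F G p : (forall q, U q -> dot (F q) (G q) = 0) ->
  is_derive p ((0, 1) : R * R) F (dv F p) ->
  is_derive p ((0, 1) : R * R) G (dv G p) -> U p ->
  dot (dv G p) (F p) = - dot (dv F p) (G p).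
Proof.
move=> FG hF hG Up; have := dot_cst_derive openU Up FG hF hG.
by rewrite [X in _ + X]dotC; lra.
Qed.

Let hk p : U p -> is_derive p ((1, 0) : R * R) kappa (du kappa p).
Proof. exact: class_C_is_derive_u smooth_kappa. Qed.
Let hku p : U p -> is_derive p ((1, 0) : R * R) (du kappa) (du (du kappa) p).
Proof. exact: class_C_is_derive_u (class_C_du smooth_kappa). Qed.
Let hkuu p : U p ->
  is_derive p ((1, 0) : R * R) (du (du kappa)) (du (du (du kappa)) p).
Proof. exact: class_C_is_derive_u (class_C_du (class_C_du smooth_kappa)). Qed.
Let ht p : U p -> is_derive p ((1, 0) : R * R) tau (du tau p).
Proof. exact: class_C_is_derive_u smooth_tau. Qed.
Let htu p : U p -> is_derive p ((1, 0) : R * R) (du tau) (du (du tau) p).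
Proof. exact: class_C_is_derive_u (class_C_du smooth_tau). Qed.
Let htuu p : U p -> is_derive p ((1, 0) : R * R) (du (du tau)) (du (du (du tau)) p).
Proof. exact: class_C_is_derive_u (class_C_du (class_C_du smooth_tau)). Qed.
Let hs p : U p -> is_derive p ((1, 0) : R * R) sigma (du sigma p).
Proof. exact: class_C_is_derive_u smooth_sigma. Qed.

Let DE p : U p -> dot (D p) (E p) = 0. Proof. by rewrite dotC; exact: ED. Qed.
Let NE p : U p -> dot (N p) (E p) = 0. Proof. by rewrite dotC; exact: EN. Qed.
Let ND p : U p -> dot (N p) (D p) = 0. Proof. by rewrite dotC; exact: DN. Qed.
Let DT p : U p -> dot (D p) (T p) = 0. Proof. by rewrite dotC; exact: TD. Qed.

Let cOmega : class_C 2 U Omega. Proof. exact: (class_C_rowW openU smoothOmega). Qed.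

Lemma dot_dvT_E p : U p -> dot (dv T p) (E p) = f12 p.
Proof.
move=> Up; have h0 := is_derive_cst (0 : R) p ((1, 0) : R * R).
have H q : U q -> dot (dv Omega q) (E q) = cst 0 q.
  by move=> Uq; rewrite dvOmega// dotZl DE// mulr0.
have := mixed_coef cOmega smoothE TE H h0 Up.
have := dot_orth_dv TE (hTv Up) (hEv Up) Up.
rewrite -/T => -> /eqP; rewrite subr0 eqr_oppLR => /eqP ->.
rewrite dvOmega// duE// dotZl dotDr !dotZr DD// DN// /f12.
by rewrite mulr0 addr0 mulr1.
Qed.

(** [f13] is the u-derivative of kappa^2 tau, the D-component of Omega_v; D_u contributes nothing,
    being parallel to [E]. *)
Lemma dot_dvT_D p : U p -> dot (dv T p) (D p) = f13 p.
Proof.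
move=> Up.
have H q : U q -> dot (dv Omega q) (D q) = kappa q * kappa q * tau q.
  by move=> Uq; rewrite dvOmega// dotZl DD// mulr1 expr2.
have h0 := is_derive_mul (is_derive_mul (hk Up) (hk Up)) (ht Up).
have := mixed_coef cOmega smoothD TD H h0 Up.
have := dot_orth_dv TD (hTv Up) (hDv Up) Up.
rewrite -/T => -> /eqP; rewrite eqr_oppLR => /eqP ->.
rewrite dvOmega// duD// dotZl dotZr DE// /f13.
by ring.
Qed.

(** Omega_v is along [D], while N_u lies in the span of [T] and [E]. *)
Lemma dot_dvT_N p : U p -> dot (dv T p) (N p) = 0.
Proof.
move=> Up; have h0 := is_derive_cst (0 : R) p ((1, 0) : R * R).
have H q : U q -> dot (dv Omega q) (N q) = cst 0 q.
  by move=> Uq; rewrite dvOmega// dotZl DN// mulr0.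
have cN1 := class_C_rowW openU smoothN.
have := mixed_coef cOmega cN1 TN H h0 Up.
have := dot_orth_dv TN (hTv Up) (hNv Up) Up.
rewrite -/T => -> /eqP; rewrite subr0 eqr_oppLR => /eqP ->.
rewrite dvOmega// duN// dotZl dotDr dotNr !dotZr DT// DE//.
by rewrite !mulr0 oppr0 addr0 mulr0 oppr0.
Qed.

Lemma dvT_expansion p : U p -> dv T p = f12 p *: E p + f13 p *: D p.
Proof.
move=> Up; rewrite [LHS](frame_expansion _ (TT Up) (EE Up) (DD Up) (NN Up)
  (TE Up) (TD Up) (TN Up) (ED Up) (EN Up) (DN Up)).
rewrite (dot_unit_dv TT (hTv Up) Up) dot_dvT_E// dot_dvT_D// dot_dvT_N//.
by rewrite !scale0r add0r addr0.
Qed.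

(** The relation is kappa <E_v, N> = sigma a13 - (a12)_u. Every term on the right has a factor
    kappa, so [f24] carries no denominator. *)
Lemma dot_dvN_E p : U p -> dot (dv N p) (E p) = - f24 p.
Proof.
move=> Up; have k0 := kappa_neq0 Up.
have hc q : U q -> dot (du T q) (E q) = 0.
  by move=> Uq; rewrite duT// dotZl NE// mulr0.
have h0 : is_derive p ((1, 0) : R * R) f12
    (- (kappa p * (2 * du kappa p * tau p * sigma p + kappa p * du tau p * sigma p
     + kappa p * tau p * du sigma p))).
  have := is_derive_mul (is_derive_cst (-1 : R) p ((1, 0) : R * R)) (is_derive_mul
    (is_derive_mul (is_derive_mul (hk Up) (hk Up)) (ht Up)) (hs Up)).
  congr is_derive; last by rewrite /cst; ring.
  by apply/funext => q; rewrite /f12 /cst mulN1r expr2.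
have := mixed_coef smoothT smoothE hc dot_dvT_E h0 Up.
rewrite dvT_expansion// duT// duE// dotZr.
rewrite (dot_orth_dv (fun q Uq => NE Uq) (hNv Up) (hEv Up) Up).
rewrite dotDl !dotZl !dotDr !dotZr ED// EN// DD// DN// => e.
apply: (mulfI k0); move: e; rewrite /f24 /f13 => e.
lra.
Qed.

(** Here kappa <D_v, N> = - sigma a12 - (a13)_u. The derivative of a13 contains 2 tau kappa_u^2,
    which has no factor kappa, so the quotient remains in [f34]. *)
Lemma dot_dvN_D p : U p -> dot (dv N p) (D p) = - f34 p.
Proof.
move=> Up; have k0 := kappa_neq0 Up.
have hc q : U q -> dot (du T q) (D q) = 0.
  by move=> Uq; rewrite duT// dotZl ND// mulr0.
have h2 := is_derive_cst (2 : R) p ((1, 0) : R * R).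
have h0 := is_derive_mul (hk Up) (is_derive_add
  (is_derive_mul (is_derive_mul h2 (ht Up)) (hku Up)) (is_derive_mul (hk Up) (htu Up))).
have := mixed_coef smoothT smoothD hc dot_dvT_D h0 Up.
rewrite dvT_expansion// duT// duD// dotZr.
rewrite (dot_orth_dv (fun q Uq => ND Uq) (hNv Up) (hDv Up) Up).
rewrite dotDl !dotZl !dotZr EE// DE// => e.
rewrite /f34; apply: (mulfI k0); rewrite -mulrN -[LHS]opprK -mulrN e /f12 /cst.
generalize (kappa p), k0, (tau p), (sigma p), (du kappa p), (du tau p),
  (du (du kappa) p), (du (du tau) p) => k k1 t s ku tu kuu tuu.
by field.
Qed.

Lemma dot_dvN_T p : U p -> dot (dv N p) (T p) = 0.
Proof.
by move=> Up; rewrite (dot_orth_dv TN (hTv Up) (hNv Up) Up) dot_dvT_N// oppr0.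
Qed.

(** With F = N and G = D the relation reads kappa a13 + tau <E_v, D> = sigma a24 + (a34)_u; the
    third derivatives of [kappa] and [tau] enter through (a34)_u. *)
Lemma dot_dvE_D p : U p -> dot (dv E p) (D p) = f23 p.
Proof.
move=> Up; have k0 := kappa_neq0 Up; have t0 := tau_neq0 Up.
have hc q : U q -> dot (du N q) (D q) = 0.
  by move=> Uq; rewrite duN// dotDl dotNl !dotZl TD// ED// !mulr0 subr0.
pose h c := is_derive_cst (c : R) p ((1, 0) : R * R).
(* kappa a34, with powers and differences spelled as products and sums so that it matches the shape
   of the derivative [hP] assembled from the rules. *)
pose P q := kappa q * tau q * (sigma q * sigma q) * kappa q +
  (-4 * du kappa q * du tau q + -1 * (kappa q * du (du tau) q)) * kappa q +
  -2 * ((du kappa q * du kappa q + kappa q * du (du kappa) q) * tau q).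
have hP := is_derive_add (is_derive_add
  (is_derive_mul (is_derive_mul (is_derive_mul (hk Up) (ht Up))
    (is_derive_mul (hs Up) (hs Up))) (hk Up))
  (is_derive_mul (is_derive_add
    (is_derive_mul (is_derive_mul (h (-4)) (hku Up)) (htu Up))
    (is_derive_mul (h (-1)) (is_derive_mul (hk Up) (htuu Up)))) (hk Up)))
  (is_derive_mul (h (-2)) (is_derive_mul (is_derive_add
    (is_derive_mul (hku Up) (hku Up)) (is_derive_mul (hk Up) (hkuu Up)))
    (ht Up))).
have hf := is_derive_mul (h (-1)) (is_derive_mul (is_derive_inv k0 (hk Up)) hP).
have H q : U q -> dot (dv N q) (D q) = -1 * ((kappa q)^-1 * P q).
  move=> Uq; rewrite dot_dvN_D// /f34 /P; have := kappa_neq0 Uq.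
  generalize (kappa q), (tau q), (sigma q), (du kappa q), (du tau q),
    (du (du kappa) q), (du (du tau) q) => k t s ku tu kuu tuu kn0.
  by field.
have := mixed_coef smoothN smoothD hc H hf Up.
rewrite duN// duD// dotDr dotNr !dotZr dot_dvN_E//.
rewrite (dot_orth_dv TD (hTv Up) (hDv Up) Up) dot_dvT_D//.
rewrite (dot_orth_dv ED (hEv Up) (hDv Up) Up) /f23 /f24 /f13 /cst.
generalize (dot (dv E p) (D p)), (kappa p), k0, (tau p), t0, (sigma p),
  (du kappa p), (du tau p), (du sigma p), (du (du kappa) p), (du (du tau) p),
  (du (du (du kappa)) p), (du (du (du tau)) p).
move=> x k kn0 t tn0 s ku tu su kuu tuu kuuu tuuu e.
(* A tautology in [x], arranged so that the left-hand side of [e] occurs in it; rewriting with [e]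
   then eliminates [x] from the right. *)
have -> : x = t^-1 * (- k * - (k * (2 * t * ku + k * tu)) - t * - x -
    k * (k * (2 * t * ku + k * tu))) by field.
by rewrite e; field; rewrite kn0 tn0.
Qed.

Let frame_exp p (Up : U p) x := frame_expansion x (TT Up) (EE Up) (DD Up) (NN Up)
  (TE Up) (TD Up) (TN Up) (ED Up) (EN Up) (DN Up).

(** The six computed products fill the whole table by skew-symmetry. The terms with coefficient 0
    are those of a14. *)
Lemma moving_frame_dv p : U p ->
  [/\ dv T p = f12 p *: E p + f13 p *: D p + 0 *: N p,
      dv E p = - f12 p *: T p + f23 p *: D p + f24 p *: N p,
      dv D p = - f13 p *: T p - f23 p *: E p + f34 p *: N p &
      dv N p = - 0 *: T p - f24 p *: E p - f34 p *: D p].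
Proof.
move=> Up; split.
- by rewrite dvT_expansion// scale0r addr0.
- rewrite [LHS](frame_exp Up) (dot_unit_dv EE (hEv Up) Up) dot_dvE_D//.
  rewrite (dot_orth_dv TE (hTv Up) (hEv Up) Up) dot_dvT_E//.
  rewrite (dot_orth_dv NE (hNv Up) (hEv Up) Up) dot_dvN_E// (opprK (f24 p)).
  by rewrite scale0r addr0.
- rewrite [LHS](frame_exp Up) (dot_unit_dv DD (hDv Up) Up).
  rewrite (dot_orth_dv TD (hTv Up) (hDv Up) Up) dot_dvT_D//.
  rewrite (dot_orth_dv ED (hEv Up) (hDv Up) Up) dot_dvE_D//.
  rewrite (dot_orth_dv ND (hNv Up) (hDv Up) Up) dot_dvN_D// (opprK (f34 p)).
  by rewrite scale0r addr0 !scaleNr.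
- rewrite [LHS](frame_exp Up) (dot_unit_dv NN (hNv Up) Up).
  rewrite dot_dvN_T// dot_dvN_E// dot_dvN_D// !scaleNr !scale0r.
  by rewrite oppr0 !add0r addr0.
Qed.

End moving_frame.

Theorem theorem1 (R : realType) (U : set (R * R))
    (Omega N : R * R -> 'rV[R]_4)
    (openU : open U)
    (smoothOmega : class_C 7 U Omega)
    (smoothN : class_C 7 U N)
    (frame : is_ED2_frame_field Omega N U)
    (BetchovDaRios : forall p, U p ->
       dv Omega p =
         tprod (du Omega p) (du (du Omega) p) (du (du (du Omega)) p))
    (kappa_neq0 : forall p, U p -> normal_curvature Omega N p != 0)
    (tau_neq0 : forall p, U p -> geodesic_torsion1 Omega N p != 0) :
  forall p, U p ->
  let T := ED2_T Omega in
  let E := ED2_E Omega N in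
  let D := ED2_D Omega N in
  let kappa := normal_curvature Omega N in
  let sigma := geodesic_curvature2 Omega N in
  let tau := geodesic_torsion1 Omega N in
  let k := kappa p in
  let k_u := du kappa p in
  let k_uu := du (du kappa) p in
  let k_uuu := du (du (du kappa)) p in
  let s := sigma p in
  let s_u := du sigma p in
  let t := tau p in
  let t_u := du tau p in
  let t_uu := du (du tau) p in
  let t_uuu := du (du (du tau)) p in
  let a12 := - (k ^+ 2 * t * s) in
  let a13 := k * (2 * t * k_u + k * t_u) in
  let a14 := 0 in
  let a24 := 2 * k * s * t_u + t * (k * s_u + 4 * s * k_u) in
  let a34 := 1 / k *
    ((k * t * s ^+ 2 - 4 * k_u * t_u - k * t_uu) * k
     - 2 * (k_u ^+ 2 + k * k_uu) * t) in
  let a23 := -1 / (t * k ^+ 2) *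
    (- (3 * k ^+ 3 * t * s * s_u) + k ^+ 5 * t_u + 2 * k ^+ 4 * t * k_u
     - 2 * t * k_u ^+ 3 - k ^+ 2 * s ^+ 2 * (3 * k * t_u + 5 * t * k_u)
     + 2 * k * k_u * (k_u * t_u + 2 * t * k_uu) + k ^+ 3 * t_uuu
     + k ^+ 2 * (5 * k_u * t_uu + 6 * t_u * k_uu + 2 * t * k_uuu)) in
  [/\ du T p = k *: N p,
      du E p = s *: D p + t *: N p,
      du D p = - s *: E p &
      du N p = - k *: T p - t *: E p] /\
  [/\ dv T p = a12 *: E p + a13 *: D p + a14 *: N p,
      dv E p = - a12 *: T p + a23 *: D p + a24 *: N p,
      dv D p = - a13 *: T p - a23 *: E p + a34 *: N p &
      dv N p = - a14 *: T p - a24 *: E p - a34 *: D p].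

Proof.
pose hTT := dotTT frame; pose hEE := dotEE frame; pose hNN := dotNN frame.
pose hTE := dotTE openU smoothOmega smoothN frame.
pose hTN := dotTN openU smoothOmega frame.
pose hEN := dotEN openU smoothOmega smoothN frame.
pose hDD := dotDD openU smoothOmega smoothN frame.
(* Orthogonality of [D] to the factors of its triple product holds at every point; the membership
   argument only restores the shape of the section hypotheses. *)
pose hTD q (_ : U q) := dotTD Omega N q.
pose hED q (_ : U q) := dotED Omega N q.
pose hDN q (_ : U q) := dotDN Omega N q.
pose hT := du_ED2_T openU smoothOmega frame.
pose hE := du_ED2_E openU smoothOmega smoothN frame.
pose hD := du_ED2_D openU smoothOmega smoothN frame kappa_neq0.
pose hN := du_ED2_N openU smoothOmega smoothN frame kappa_neq0.
have dvO q : U q -> dv Omega q = (normal_curvature Omega N q ^+ 2 *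
    geodesic_torsion1 Omega N q) *: ED2_D Omega N q.
  move=> Uq; rewrite BetchovDaRios//.
  exact: (Betchov_Da_Rios_D openU smoothOmega smoothN frame kappa_neq0).
have W n (F : R * R -> 'rV[R]_4) : class_C n.+1 U F -> class_C n U F.
  exact: (class_C_rowW openU).
(* Schwarz's theorem is applied to T = Omega_u and to [N], hence order 3 for [Omega] and 2 for [N];
   [kappa] and [tau] need order 3 for a23. *)
have cO : class_C 3 U Omega := W _ _ (W _ _ (W _ _ (W _ _ smoothOmega))).
have cE : class_C 1 U (ED2_E Omega N).
  exact: (W _ _ (W _ _ (W _ _ (class_C_ED2_E openU smoothOmega smoothN frame)))).
have cD : class_C 1 U (ED2_D Omega N).
  exact: (W _ _ (W _ _ (W _ _ (class_C_ED2_D openU smoothOmega smoothN frame)))).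
have cN : class_C 2 U N.
  exact: (W _ _ (W _ _ (W _ _ (W _ _ (W _ _ smoothN))))).
have ck := class_CW openU (class_CW openU
  (class_C_ED2_kappa openU smoothOmega smoothN)).
have cs := class_CW openU (class_CW openU
  (class_C_ED2_sigma openU smoothOmega smoothN frame)).
have ct := class_C_ED2_tau openU smoothOmega smoothN frame.
move=> p Up; split; first by split; [exact (hT p Up)|exact (hE p Up)|
  exact (hD p Up)|exact (hN p Up)].
exact (moving_frame_dv openU cO cE cD cN ck cs ct hTT hEE hDD hNN hTE hTD hTN
  hED hEN hDN hT hE hD hN dvO kappa_neq0 tau_neq0 Up).
Qed.
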